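(* Let $(\mathbb V,\mathbb E,\mathbf P,\mathcal W)$ be a weighted Markovian graph satisfying assumption (A) (see context), and let $K(\mathbf P,\mathcal W)=\sum_{i,j\in\mathbb V}\boldsymbol\pi(i)\mathbf M(i,j)\boldsymbol\pi(j)$. Then, with $\mathbf P$ held fixed, for every $(l,k)\in\mathbb E$, $$\frac{\partial K(\mathbf P,\mathcal W)}{\partial\mathbf W(l,k)}=\mathrm{tr}(\mathbf Z)\,\boldsymbol\pi(l)\,\mathbf P(l,k).$$
   Context: Weighted Markovian graph $(\mathbb V,\mathbb E,\mathbf P,\mathcal W)$: $\mathbb V=\{1,\dots,n\}$; $\mathbb E\subseteq\mathbb V\times\mathbb V$; the graph is strongly connected; $\mathbf P$ is a row-stochastic $n\times n$ matrix with $\mathbf P(i,j)\ge 0$ for $(i,j)\in\mathbb E$ and $\mathbf P(i,j)=0$ otherwise, assumed irreducible and (unless otherwise stated) aperiodic. The weights $\mathcal W(i,j)$ (random, or deterministic as a special case) take values in $[\epsilon,\infty)$ for $(i,j)\in\mathbb E$, for some $\epsilon>0$, and are zero otherwise. Assumption (A): $\mathbf P$ has a unique stationary distribution $\boldsymbol\pi$ (a row vector), and $\mathbf W(i,j)=\mathbb E[\mathcal W(i,j)]<\infty$, $\mathbf W^{(2)}(i,j)=\mathbb E[\mathcal W(i,j)^2]<\infty$ for $(i,j)\in\mathbb E$. Let $(\hat X_k)_{k\ge0}$ be the Markov chain with transition matrix $\mathbf P$. For $\hat X_0=i$ let $\hat\tau(i,j)=\inf\{m\ge1:\hat X_m=j\}$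 (first return time if $i=j$), and let $\tau(i,j)$ be the sum of the weights $\mathcal W(\hat X_{k-1},\hat X_k)$ over the transitions $k=1,\dots,\hat\tau(i,j)$; the weights are independent of the chain, so a traversal of edge $(a,b)$ has conditional mean weight $\mathbf W(a,b)$. Set $\mathbf M(i,j)=\mathbb E[\tau(i,j)]$; $\mathbf M$ and hence $K(\mathbf P,\mathcal W)$ depend on the weights only through $\mathbf W$ and are regarded as functions of $\mathbf W$. Notation: $\Pi=\mathbf 1\boldsymbol\pi$ with $\mathbf 1$ the all-ones column vector; $\mathbf Z=(\mathbf I-\mathbf P+\Pi)^{-1}$; $\mathrm{tr}$ is the trace. *)

(* Defs.v *)
From HB Require Import structures.
From mathcomp Require Export all_boot all_order all_algebra.
From mathcomp Require Export all_classical all_reals all_analysis.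

Set Implicit Arguments.
Unset Strict Implicit.
Unset Printing Implicit Defensive.

Export Order.TTheory GRing.Theory Num.Theory.
Export numFieldNormedType.Exports.

Local Open Scope classical_set_scope.
Local Open Scope ring_scope.

(* The vertex set {1, ..., n} is 'I_n, and a set of directed edges is a        *)
(* relation on 'I_n (self-loops allowed).                                      *)

Definition strongly_connected (n : nat) (E : rel 'I_n) : Prop :=
  forall i j, connect E i j.

Definition irreducible_chain (R : realType) (n : nat) (P : 'M[R]_n) : Prop :=
  forall i j, exists m : nat, 0 < (P ^+ m) i j.

(* The greatest common divisor of the return times to each state is 1.         *)
Definition aperiodic_chain (R : realType) (n : nat) (P : 'M[R]_n) : Prop :=
  forall (i : 'I_n) (p : nat),
    (forall m : nat, (0 < m)%N -> 0 < (P ^+ m) i i -> (p %| m)%N) -> p = 1%N.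

Record markovian_graph (R : realType) (n : nat) (E : rel 'I_n)
    (P : 'M[R]_n) : Prop := MarkovianGraph {
  mg_connected : strongly_connected E;
  mg_edge : forall i j, E i j -> 0 <= P i j;
  mg_nonedge : forall i j, ~~ E i j -> P i j = 0;
  mg_stochastic : forall i, \sum_(j < n) P i j = 1;
  mg_irreducible : irreducible_chain P;
  mg_aperiodic : aperiodic_chain P }.

Definition stationary (R : realType) (n : nat) (P : 'M[R]_n)
    (pi : 'rV[R]_n) : Prop :=
  [/\ forall i, 0 <= pi 0 i, \sum_(i < n) pi 0 i = 1 & pi *m P = pi].

Definition unique_stationary (R : realType) (n : nat) (P : 'M[R]_n)
    (pi : 'rV[R]_n) : Prop :=
  stationary P pi /\ (forall mu : 'rV[R]_n, stationary P mu -> mu = pi).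

Definition edge_weight_range (R : realType) (n : nat) (E : rel 'I_n) (eps : R)
    (T : Type) (f : 'I_n -> 'I_n -> T -> R) : Prop :=
  forall a b t, (E a b -> eps <= f a b t) /\ (~~ E a b -> f a b t = 0).

Definition mean_weight (R : realType) (n : nat) (d : measure_display)
    (T : measurableType d) (Q : probability T R)
    (wt : 'I_n -> 'I_n -> {mfun T >-> R}) : 'M[R]_n :=
  \matrix_(a, b) fine ('E_Q[wt a b])%E.

Record weight_assumptions (R : realType) (n : nat) (E : rel 'I_n) (eps : R)
    (d : measure_display) (T : measurableType d) (Q : probability T R)
    (wt : 'I_n -> 'I_n -> {mfun T >-> R}) : Prop := WeightAssumptions {
  wa_eps : 0 < eps;
  wa_range : edge_weight_range E eps (fun a b => wt a b);
  wa_mean : forall a b, E a b -> ('E_Q[wt a b] < +oo)%E;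
  wa_mean2 : forall a b, E a b -> ('E_Q[fun t => (wt a b t ^+ 2)%R] < +oo)%E }.

(* Under Pr the process X is a Markov chain started at i with transition       *)
(* matrix P: the Markov property is written in product form, so that it also   *)
(* makes sense for histories of probability zero.                              *)
Record markov_chain (R : realType) (n : nat) (P : 'M[R]_n) (i : 'I_n)
    (d : measure_display) (Om : measurableType d) (Pr : probability Om R)
    (X : nat -> Om -> 'I_n) : Prop := MarkovChain {
  mc_measurable : forall k j, measurable (X k @^-1` [set j]);
  mc_init : Pr (X 0%N @^-1` [set i]) = 1%E;
  mc_step : forall (m : nat) (x : nat -> 'I_n) (b : 'I_n),
    Pr ([set o | forall k, (k <= m)%N -> X k o = x k] `&` X m.+1 @^-1` [set b])
    = (Pr [set o | forall k, (k <= m)%N -> X k o = x k] * (P (x m) b)%:E)%E }.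

Definition chain_sigma (n : nat) (Om : Type) (X : nat -> Om -> 'I_n)
    : set (set Om) :=
  <<s [set A | exists k j, A = X k @^-1` [set j]] >>.

Definition weight_sigma (R : realType) (n : nat) (d : measure_display)
    (Om : measurableType d) (w : nat -> 'I_n -> 'I_n -> {mfun Om >-> R})
    : set (set Om) :=
  <<s [set A | exists k a b (B : set R),
                 measurable B /\ A = w k a b @^-1` B] >>.

(* Pr i is the law of the weighted walk started at i, and w k a b is the       *)
(* weight charged if the k-th transition uses the edge (a, b).  Each w k a b   *)
(* is a copy of wt a b, and the whole family w is independent of the chain.    *)
(* No joint law is imposed on the family w itself, so weights drawn once and   *)
(* for all and weights redrawn at each transition are both covered.            *)
Record weighted_walk (R : realType) (n : nat) (E : rel 'I_n) (P : 'M[R]_n)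
    (eps : R) (d : measure_display) (T : measurableType d)
    (Q : probability T R) (wt : 'I_n -> 'I_n -> {mfun T >-> R})
    (d' : measure_display) (Om : measurableType d')
    (Pr : 'I_n -> probability Om R) (X : nat -> Om -> 'I_n)
    (w : nat -> 'I_n -> 'I_n -> {mfun Om >-> R}) : Prop := WeightedWalk {
  ww_chain : forall i, markov_chain P i (Pr i) X;
  ww_range : forall k, edge_weight_range E eps (fun a b => w k a b);
  ww_law : forall i k a b (B : set R), measurable B ->
    Pr i (w k a b @^-1` B) = Q (wt a b @^-1` B);
  ww_indep : forall i (A B : set Om), chain_sigma X A -> weight_sigma w B ->
    Pr i (A `&` B) = (Pr i A * Pr i B)%E }.

Definition hit_time (R : realType) (n : nat) (Om : Type) (X : nat -> Om -> 'I_n)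
    (j : 'I_n) (o : Om) : \bar R :=
  ereal_inf [set (m%:R)%:E | m in [set m : nat | (1 <= m)%N /\ X m o = j]].

Definition weighted_hit_time (R : realType) (n : nat) (Om : Type)
    (X : nat -> Om -> 'I_n) (w : nat -> 'I_n -> 'I_n -> Om -> R)
    (j : 'I_n) (o : Om) : \bar R :=
  (\sum_(1 <= k <oo | (k%:R)%:E <= hit_time R X j o)
     (w k (X k.-1 o) (X k o) o)%:E)%E.

Definition mean_hit_time (R : realType) (n : nat) (d : measure_display)
    (Om : measurableType d) (Pr : 'I_n -> probability Om R)
    (X : nat -> Om -> 'I_n) (w : nat -> 'I_n -> 'I_n -> {mfun Om >-> R})
    (i j : 'I_n) : \bar R :=
  (\int[Pr i]_o weighted_hit_time X (fun k a b => w k a b) j o)%E.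

Definition weighted_kemeny (R : realType) (n : nat) (pi : 'rV[R]_n)
    (d : measure_display) (Om : measurableType d)
    (Pr : 'I_n -> probability Om R) (X : nat -> Om -> 'I_n)
    (w : nat -> 'I_n -> 'I_n -> {mfun Om >-> R}) : \bar R :=
  (\sum_(i < n) \sum_(j < n)
     (pi 0 i)%:E * mean_hit_time Pr X w i j * (pi 0 j)%:E)%E.

(* K expresses the weighted Kemeny constant as a function of the matrix of     *)
(* mean weights, with E and P (hence pi) held fixed.  As K is real-valued, the *)
(* constant is in particular finite.  The values of K at matrices that are not *)
(* mean weight matrices on E are irrelevant.                                   *)
Definition kemeny_function (R : realType) (n : nat) (E : rel 'I_n)
    (P : 'M[R]_n) (pi : 'rV[R]_n) (K : 'M[R]_n -> R) : Prop :=
  forall (eps : R) (d : measure_display) (T : measurableType d)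
    (Q : probability T R) (wt : 'I_n -> 'I_n -> {mfun T >-> R})
    (d' : measure_display) (Om : measurableType d')
    (Pr : 'I_n -> probability Om R) (X : nat -> Om -> 'I_n)
    (w : nat -> 'I_n -> 'I_n -> {mfun Om >-> R}),
    weight_assumptions E eps Q wt ->
    weighted_walk E P eps Q wt Pr X w ->
    weighted_kemeny pi Pr X w = (K (mean_weight Q wt))%:E.

Definition stationary_mx (R : realType) (n : nat) (pi : 'rV[R]_n) : 'M[R]_n :=
  (const_mx 1 : 'cV[R]_n) *m pi.

Definition fundamental_mx (R : realType) (n : nat) (P : 'M[R]_n)
    (pi : 'rV[R]_n) : 'M[R]_n :=
  invmx (1%:M - P + stationary_mx pi).

(* Main.v *)
Require Import Defs.
From mathcomp Require Import measurable_realfun ring lra.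

(** The weighted Kemeny constant is linear in the mean weights:
    [K = tr Z * (pi c)], where [c a = sum_b P a b * W a b] is the mean weight of
    one transition from [a], so that [pi c = sum_(a, b) pi a * P a b * W a b].
    The derivative in the entry [(l, k)] can be read off.

    The mean hitting weight [M i j] is expanded over transitions.  Transition
    [k.+1] is charged when the chain avoids [j] at times [1] to [k]; this event
    concerns the chain alone, so by independence its contribution is
    [(T^k c) i], where [T] is [P] with column [j] set to zero
    ([taboo_event_prob], [mean_hit_time_series]).  Hence [M i j] is the sum of
    the series [sum_k (T^k c) i].

    This series converges: applying [pi] to its partial sums bounds them at [j]
    by [pi c / pi j], and irreducibility carries the bound to all states
    ([taboo_sum_return], [taboo_sum_bounded]).  Its sum satisfies the first-step
    equations [M = c 1^T + P (M - D)], with [D] the diagonal of [M].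
    Multiplying them by [pi] gives [D], and multiplying them by [Z] then gives
    [sum_(i, j) pi i * M i j * pi j = tr Z * (pi c)] ([kemeny_identity]).

    Finally, a small change of the weight of an edge keeps the weights bounded
    below by a positive constant, so every nearby matrix on the line through
    [W] in the direction of the edge is the mean weight matrix of a walk with
    constant weights on the same chain.  A function expressing the Kemeny
    constant therefore agrees with the linear formula near [W] on that line. *)

Set Implicit Arguments.
Unset Strict Implicit.
Unset Printing Implicit Defensive.

Local Open Scope classical_set_scope.
Local Open Scope ring_scope.

(** * Stationary rows and invertibility *)

Section Stationary.
Variables (R : realType) (n : nat) (P : 'M[R]_n) (pi : 'rV[R]_n).

Lemma stationary_mul_exp m : pi *m P = pi -> pi *m P ^+ m = pi.
Proof.
move=> piP; elim: m => [|m IHm]; first by rewrite expr0 mulmx1.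
by rewrite exprSr mulmxA IHm.
Qed.

Lemma mx_exp_ge0 (A : 'M[R]_n) m i j :
  (forall a b, 0 <= A a b) -> 0 <= (A ^+ m) i j.
Proof.
move=> A0; elim: m i j => [|m IHm] i j.
  by rewrite expr0 mxE; case: (_ == _).
by rewrite exprS mxE sumr_ge0 // => a _; rewrite mulr_ge0.
Qed.

(** Stationarity moves mass along every path, so a state of positive mass
    sends some of it to each state it reaches. *)
Lemma stationary_gt0 : (forall i j, 0 <= P i j) -> irreducible_chain P ->
  stationary P pi -> forall j, 0 < pi 0 j.
Proof.
move=> P0 irr [pi0 pi1 piP] j.
have [i pii] : exists i, 0 < pi 0 i.
  apply: contrapT => /forallNP npi; have /eqP := pi1.
  rewrite big1 => [|i _]; first by rewrite eq_sym oner_eq0.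
  by apply/eqP; rewrite eq_le pi0 andbT leNgt; apply/negP/npi.
have [m Pm] := irr i j.
rewrite -(stationary_mul_exp m piP) mxE (bigD1 i) //= ltr_pwDl ?mulr_gt0 //.
by apply: sumr_ge0 => a _; rewrite mulr_ge0 // mx_exp_ge0.
Qed.

End Stationary.

Lemma stochastic_mul_ones (R : realType) (n : nat) (P : 'M[R]_n) :
  (forall i, \sum_j P i j = 1) -> P *m const_mx 1 = const_mx 1 :> 'cV[R]_n.
Proof.
move=> P1; apply/colP => i; rewrite !mxE -[RHS](P1 i).
by apply: eq_bigr => j _; rewrite mxE mulr1.
Qed.

Lemma distribution_mul_ones (R : realType) (n : nat) (pi : 'rV[R]_n) :
  \sum_i pi 0 i = 1 -> pi *m (const_mx 1 : 'cV[R]_n) = 1%:M.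
Proof.
move=> pi1; apply/rowP => i; rewrite !ord1 !mxE eqxx -[RHS]pi1.
by apply: eq_bigr => j _; rewrite mxE mulr1.
Qed.

(** A row [u] killed by [I - P + Pi] has total mass zero and satisfies
    [u P = u].  Since [pi] is positive everywhere, [pi] plus a small multiple
    of [u] is again a stationary distribution, and uniqueness gives [u = 0]. *)
Lemma fundamental_unitmx (R : realType) (n : nat) (P : 'M[R]_n)
    (pi : 'rV[R]_n) :
  (forall i, \sum_j P i j = 1) -> (forall j, 0 < pi 0 j) ->
  unique_stationary P pi -> 1%:M - P + stationary_mx pi \in unitmx.
Proof.
move=> P1 pi_gt0 [[pi0 pi1 piP] uni].
pose one : 'cV[R]_n := const_mx 1.
have Pone : P *m one = one by exact: stochastic_mul_ones.
have pione : pi *m one = 1%:M by exact: distribution_mul_ones.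
rewrite -row_free_unit -kermx_eq0; apply/rowV0P => u /sub_kermxP.
rewrite /stationary_mx -/one => uA.
have u1 : u *m one = 0.
  have := congr1 (mulmxr one) uA; rewrite /= mul0mx -mulmxA !mulmxDl mulNmx.
  by rewrite mul1mx Pone subrr add0r -!mulmxA pione mulmx1.
have uP : u *m P = u.
  move: uA; rewrite mulmxDr mulmxA u1 mul0mx addr0 mulmxBr mulmx1.
  by move/eqP; rewrite subr_eq0 => /eqP.
(* The sum of the ratios |u i| / pi i bounds each of them; the leading 1 keeps
   it invertible when u = 0. *)
have [e e0 epos] : exists2 e : R, 0 < e & forall i, 0 <= pi 0 i + e * u 0 i.
  pose s := 1 + \sum_i `|u 0 i| / pi 0 i.
  have s_gt0 : 0 < s.
    by rewrite ltr_pwDl ?ltr01 // sumr_ge0 // => i _; rewrite divr_ge0 // ltW.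
  exists s^-1; first by rewrite invr_gt0.
  move=> i; have : `|u 0 i| / pi 0 i <= s.
    rewrite /s (bigD1 i) //= addrCA lerDl addr_ge0 // sumr_ge0 // => j _.
    by rewrite divr_ge0 // ltW.
  rewrite ler_pdivrMr // => le1.
  have := ler_norm (- u 0 i); rewrite normrN => le2.
  rewrite -(pmulr_rge0 _ s_gt0) mulrDr mulrA divff ?gt_eqF // mul1r; lra.
have /uni : stationary P (pi + e *: u).
  split=> [i||]; first by rewrite !mxE.
    transitivity (((pi + e *: u) *m one) 0 0).
      by rewrite mxE; apply: eq_bigr => j _; rewrite [one _ _]mxE mulr1.
    by rewrite mulmxDl -scalemxAl u1 pione scaler0 addr0 mxE eqxx.
  by rewrite mulmxDl -scalemxAl uP piP.
by move/eqP; rewrite -subr_eq0 addrC addKr scaler_eq0 gt_eqF //= => /eqP->.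
Qed.

Lemma stationary_mxE (R : realType) (n : nat) (pi : 'rV[R]_n) i j :
  stationary_mx pi i j = pi 0 j.
Proof. by rewrite !mxE big_ord1 !mxE mul1r. Qed.

(** * From the first-step equations to the trace of Z *)

Section KemenyIdentity.
Variables (R : realType) (n : nat) (P : 'M[R]_n) (pi : 'rV[R]_n).
Local Notation one := (const_mx 1 : 'cV[R]_n).
Local Notation Z := (fundamental_mx P pi).
Local Notation Pi := (stationary_mx pi).

Hypothesis P1 : forall i, \sum_j P i j = 1.
Hypothesis pi_stat : stationary P pi.
Hypothesis unitA : 1%:M - P + stationary_mx pi \in unitmx.

Let Pone : P *m one = one. Proof. exact: stochastic_mul_ones. Qed.

Let pi1 : \sum_j pi 0 j = 1. Proof. by case: pi_stat. Qed.

Let pione : pi *m one = 1%:M. Proof. exact: distribution_mul_ones. Qed.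

Let piP : pi *m P = pi. Proof. by case: pi_stat. Qed.

Lemma row_mul_fundamental : pi *m Z = pi.
Proof.
apply: (can_inj (mulmxK unitA)); rewrite mulmxKV //.
by rewrite mulmxDr mulmxBr mulmx1 piP subrr add0r mulmxA pione mul1mx.
Qed.

Lemma fundamental_mul_ones : Z *m one = one.
Proof.
apply: (can_inj (mulKmx unitA)); rewrite mulKVmx //.
by rewrite mulmxDl mulmxBl mul1mx Pone subrr add0r -mulmxA pione mulmx1.
Qed.

Lemma fundamental_mul_transition : Z *m P = Z - 1%:M + Pi.
Proof.
have := mulVmx unitA; rewrite -/(fundamental_mx P pi) mulmxDr mulmxBr mulmx1.
rewrite {2}/stationary_mx mulmxA fundamental_mul_ones -/(stationary_mx pi) => <-.
by rewrite opprD opprB !addrA subrK addrAC subrr add0r.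
Qed.

Variables (c : 'cV[R]_n) (M : 'M[R]_n).
Hypothesis M_first_step :
  forall i j, M i j = c i 0 + \sum_(b | b != j) P i b * M b j.

Let D : 'M[R]_n := diag_mx (\row_j M j j).
Let cbar : R := (pi *m c) 0 0.

Lemma first_step_mx : M = c *m one^T + P *m (M - D).
Proof.
apply/matrixP => i j; rewrite M_first_step !mxE big_ord1 !mxE mulr1.
congr (_ + _); rewrite [RHS](bigD1 j) //= !mxE eqxx mulr1n subrr mulr0 add0r.
by apply: eq_bigr => b bj; rewrite !mxE (negPf bj) mulr0n subr0.
Qed.

(** Applying [pi] to [M = c 1^T + P (M - D)] cancels [pi M]: the mean weight of
    an excursion from [j] is the mean weight of a stationary step divided by
    [pi j]. *)
Lemma mean_return j : pi 0 j * M j j = cbar.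
Proof.
have piD : pi *m D = pi *m c *m one^T.
  have := congr1 (mulmx pi) first_step_mx.
  rewrite mulmxDr !mulmxA piP mulmxBr => H; apply/rowP => k.
  by have := congr1 (fun A : 'rV[R]_n => A 0 k) H; rewrite !mxE; lra.
have := congr1 (fun A : 'rV[R]_n => A 0 j) piD.
by rewrite /cbar mul_mx_diag !mxE big_ord1 !mxE mulr1.
Qed.

(** Multiplying the first-step equation by [Z] and using
    [Z P = Z - I + Pi] solves it for [Pi M].  On the diagonal [M] and [D]
    cancel, and each remaining [M j j] is multiplied by [pi j] in the weighted
    sum, hence becomes the stationary step cost by [mean_return]; the terms
    [- pi Z c] and [pi c] cancel and the trace of [Z] remains. *)
Lemma kemeny_identity :
  \sum_i \sum_j pi 0 i * M i j * pi 0 j = \tr Z * (pi *m c) 0 0.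
Proof.
have HZ : Pi *m M = M - Z *m c *m one^T + Z *m D - D + Pi *m D.
  have := congr1 (mulmx Z) first_step_mx.
  rewrite mulmxDr !mulmxA fundamental_mul_transition.
  rewrite mulmxDl mulmxBl mul1mx !mulmxBr.
  move=> H; apply/matrixP => i j.
  by have := congr1 (fun A : 'M[R]_n => A i j) H; rewrite !mxE; lra.
have column_sum j : \sum_i pi 0 i * M i j * pi 0 j =
    - (pi 0 j * (Z *m c) j 0) + Z j j * cbar + cbar * pi 0 j.
  have Ejj := congr1 (fun A : 'M[R]_n => A j j) HZ.
  have PiM : (Pi *m M) j j = \sum_i pi 0 i * M i j.
    by rewrite mxE; apply: eq_bigr => i _; rewrite stationary_mxE.
  have PiD : (Pi *m D) j j = pi 0 j * M j j.
    by rewrite mul_mx_diag mxE stationary_mxE mxE.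
  have ZD : (Z *m D) j j = Z j j * M j j by rewrite mul_mx_diag mxE [in LHS]mxE.
  have Zc : (Z *m c *m one^T) j j = (Z *m c) j 0.
    by rewrite [LHS]mxE big_ord1 [X in _ * X]mxE [X in _ * X]mxE mulr1.
  have Dj : D j j = M j j by rewrite !mxE eqxx mulr1n.
  have {Ejj} -> : \sum_i pi 0 i * M i j * pi 0 j =
      (- (Z *m c) j 0 + Z j j * M j j + pi 0 j * M j j) * pi 0 j.
    rewrite -mulr_suml -PiM; congr (_ * _); move: Ejj.
    rewrite -PiD -ZD -Zc; set A := Z *m c *m _; set B := Z *m D => ->.
    by rewrite !mxE; rewrite !mxE in Dj; rewrite Dj; ring.
  rewrite mean_return -(mean_return j); ring.
rewrite exchange_big /= (eq_bigr _ (fun j _ => column_sum j)).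
rewrite 2!big_split /= sumrN.
have -> : \sum_j pi 0 j * (Z *m c) j 0 = cbar.
  rewrite -[RHS](congr1 (fun u => (u *m c) 0 0) row_mul_fundamental).
  by rewrite -mulmxA [in RHS]mxE.
rewrite -mulr_suml -mulr_sumr /mxtrace.
by rewrite pi1 mulr1 addrAC addNr add0r.
Qed.

End KemenyIdentity.

(** * Sums over paths that avoid the target *)

Section Taboo.
Variables (R : realType) (n : nat) (P : 'M[R]_n).

(** The chain killed when it steps onto [j]: the entry [(a, b)] of the [k]-th
    power is the probability of going from [a] to [b] in [k] steps without
    visiting [j] after time 0. *)
Definition taboo_mx (j : 'I_n) : 'M[R]_n :=
  \matrix_(a, b) (if b == j then 0 else P a b).

(** With [c] the mean weight of one step, this collects the mean weight
    charged during the first [N] steps up to the first visit to [j]. *)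
Definition taboo_sum (c : 'cV[R]_n) (j : 'I_n) (N : nat) : 'cV[R]_n :=
  \sum_(k < N) taboo_mx j ^+ k *m c.

Variables (c : 'cV[R]_n) (j : 'I_n).
Local Notation S := (taboo_sum c j).

Lemma taboo_sumS N i :
  S N.+1 i 0 = c i 0 + \sum_(b | b != j) P i b * S N b 0.
Proof.
have -> : S N.+1 = c + taboo_mx j *m S N.
  rewrite /taboo_sum big_ord_recl expr0 mul1mx mulmx_sumr; congr (_ + _).
  by apply: eq_bigr => k _; rewrite exprS -mulmxA.
rewrite mxE [X in _ + X]mxE (bigD1 j) //= [taboo_mx _ _ _]mxE eqxx mul0r add0r.
congr (_ + _); apply: eq_bigr => b bj.
by rewrite [taboo_mx _ _ _]mxE (negPf bj).
Qed.

Hypothesis P_ge0 : forall a b, 0 <= P a b.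
Hypothesis c_ge0 : forall a, 0 <= c a 0.

Lemma taboo_term_ge0 k i : 0 <= (taboo_mx j ^+ k *m c) i 0.
Proof.
rewrite mxE sumr_ge0 // => a _; rewrite mulr_ge0 // mx_exp_ge0 // => x y.
by rewrite mxE; case: ifP.
Qed.

Lemma taboo_sum_ge0 N i : 0 <= S N i 0.
Proof. by rewrite summxE sumr_ge0 // => k _; exact: taboo_term_ge0. Qed.

Lemma taboo_sum_leS N i : S N i 0 <= S N.+1 i 0.
Proof. by rewrite /taboo_sum big_ord_recr mxE lerDl taboo_term_ge0. Qed.

Hypothesis irr : irreducible_chain P.
Variable pi : 'rV[R]_n.
Hypothesis pi_stat : stationary P pi.

(** The partial sums increase with [N], while stationarity makes their
    [pi]-average grow by exactly [pi c - pi j * S N j]; so this increment is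
    nonnegative. *)
Lemma taboo_sum_return N : S N j 0 <= (pi *m c) 0 0 / pi 0 j.
Proof.
have pi_gt0 := stationary_gt0 P_ge0 irr pi_stat.
have [pi0 pi1 piP] := pi_stat.
rewrite ler_pdivlMr //.
have key : \sum_i pi 0 i * S N.+1 i 0 =
    (pi *m c) 0 0 + \sum_i pi 0 i * S N i 0 - pi 0 j * S N j 0.
  under eq_bigr do rewrite taboo_sumS mulrDr mulr_sumr.
  rewrite big_split /= mxE -addrA; congr (_ + _).
  rewrite exchange_big /= [in RHS](bigD1 j) //= addrAC subrr add0r.
  apply: eq_bigr => b _; rewrite -{2}piP mxE mulr_suml.
  by apply: eq_bigr => a _; rewrite mulrA.
have : \sum_i pi 0 i * S N i 0 <= \sum_i pi 0 i * S N.+1 i 0.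
  by apply: ler_sum => i _; rewrite ler_wpM2l // taboo_sum_leS.
by rewrite key mulrC; lra.
Qed.

(** The bound at [j] propagates along edges: [S N.+1 a] dominates
    [P a b * S N b] when [b] differs from [j]. *)
Lemma taboo_sum_bounded i : exists B, forall N, S N i 0 <= B.
Proof.
have [m] := irr j i; elim: m i => [|m IHm] i.
  rewrite expr0 mxE; have [<- _|_] := eqVneq j i; last by rewrite ltxx.
  by exists ((pi *m c) 0 0 / pi 0 j) => N; exact: taboo_sum_return.
rewrite exprSr mxE => Pji.
have [->|ij] := eqVneq i j.
  by exists ((pi *m c) 0 0 / pi 0 j) => N; exact: taboo_sum_return.
have [a] : exists a, 0 < (P ^+ m) j a * P a i.
  apply: contrapT => /forallNP npi; move: Pji; rewrite ltNge => /negP; apply.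
  by apply: sumr_le0 => a _; rewrite leNgt; apply/negP/npi.
have Pm0 := mx_exp_ge0 m j a P_ge0.
move=> Pa; have Pai : 0 < P a i.
  by rewrite lt_def P_ge0 andbT; apply: contraTneq Pa => ->; rewrite mulr0 ltxx.
have /IHm [B SB] : 0 < (P ^+ m) j a.
  by rewrite lt_def Pm0 andbT; apply: contraTneq Pa => ->; rewrite mul0r ltxx.
exists (B / P a i) => N; rewrite ler_pdivlMr // mulrC.
apply: le_trans (SB N.+1); rewrite taboo_sumS (bigD1 i) //= addrCA lerDl.
by rewrite addr_ge0 // sumr_ge0 // => b _; rewrite mulr_ge0 // taboo_sum_ge0.
Qed.

Lemma taboo_sum_cvg i : cvgn (fun N => S N i 0).
Proof.
apply: nondecreasing_is_cvgn.
  by apply/nondecreasing_seqP => N; exact: taboo_sum_leS.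
by have [B SB] := taboo_sum_bounded i; exists B => _ [N _ <-]; exact: SB.
Qed.

Lemma taboo_limit_first_step i :
  limn (fun N => S N i 0) =
  c i 0 + \sum_(b | b != j) P i b * limn (fun N => S N b 0).
Proof.
apply: cvg_lim => //; rewrite -cvg_shiftS /=.
under eq_fun do rewrite taboo_sumS.
apply: cvgD; first exact: cvg_cst.
apply: cvg_big => [|b _]; first exact: add_continuous.
by apply: cvgM; [exact: cvg_cst|exact: taboo_sum_cvg].
Qed.

End Taboo.

(** * Two facts on measures *)

Section FiberSum.
Variables (R : realType) (d : measure_display) (Om : measurableType d).
Variables (mu : {measure set Om -> \bar R}) (I : finType) (Y : Om -> I).

Lemma measure_fiber_sum (G : set Om) : measurable G ->
  (forall a, measurable (Y @^-1` [set a])) ->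
  mu G = (\sum_a mu (G `&` Y @^-1` [set a]))%E.
Proof.
move=> mG mY.
have GE : G = \bigcup_(a in [set` index_enum I]) (G `&` Y @^-1` [set a]).
  apply/seteqP; split=> [x Gx|x [a _ [Gx _]]] //.
  by exists (Y x) => //; exact: mem_index_enum.
rewrite [in LHS]GE measure_fin_bigcup //.
- by rewrite [RHS]fsbig_seq ?index_enum_uniq.
- by move=> a b _ _ [x [[_ <-] [_ <-]]].
- by move=> a _; apply: measurableI.
Qed.
End FiberSum.

Section IndependentFactor.
Variables (R : realType) (d d' : measure_display).
Variables (T : measurableType d) (Om : measurableType d').
Variables (mu : {measure set Om -> \bar R}) (nu : {measure set T -> \bar R}).
Variables (f : {mfun Om >-> R}) (h : {mfun T >-> R}).
Variables (A : set Om) (a : {nonneg R}).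

(** Compare the laws of [\1_A * f] under [mu] and of [h] under [nu].  Away from
    [0] the first is [a] times the second, and [0] does not contribute to the
    integral of the identity; hence the restriction to the positive
    half-line. *)
Lemma integral_indic_indep : measurable A ->
  (forall o, 0 <= f o) -> (forall t, 0 <= h t) ->
  (forall B : set R, measurable B ->
    mu (A `&` f @^-1` B) = (a%:num%:E * nu (h @^-1` B))%E) ->
  (\int[mu]_o (\1_A o * f o)%:E = a%:num%:E * \int[nu]_t (h t)%:E)%E.
Proof.
move=> mA f0 h0 fh.
pose g o : R := \1_A o * f o.
have mg : measurable_fun setT g.
  by apply: measurable_funM => //; exact: measurable_realfun.measurable_indic.
pose D : set R := `]0, +oo[%classic.
have mD : measurable D by exact: measurable_itv.
have integral_law d0 (U : measurableType d0)
    (m : {measure set U -> \bar R}) (k : U -> R) :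
    measurable_fun setT k -> (forall x, 0 <= k x) ->
    (\int[m]_x (k x)%:E = \int[pushforward m k]_(y in D) y%:E)%E.
  move=> mk k0; rewrite [RHS](ge0_integral_pushforward mk) //.
  - rewrite [RHS]integral_mkcond; apply: eq_integral => x _ /=.
    rewrite /patch; case: ifPn => // /negP xD; congr EFin; apply/eqP.
    rewrite eq_le k0 andbT leNgt; apply/negP => kx; apply: xD.
    by rewrite inE /D /= in_itv /= kx.
  - by move=> y; rewrite inE /D /= in_itv /= andbT => /ltW; rewrite lee_fin.
transitivity (\int[pushforward mu g]_(y in D) y%:E)%E.
  by apply: integral_law => // o; rewrite /g mulr_ge0.
rewrite (integral_law _ _ nu h) //.
rewrite -(ge0_integral_mscale _ mD) //; last first.
  by move=> y; rewrite /D /= in_itv /= andbT => /ltW; rewrite lee_fin.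
apply: eq_measure_integral => B mB BD.
transitivity (mu (A `&` f @^-1` B)); last exact: fh.
congr (mu _); apply/seteqP; split => x /=; rewrite /g.
  move=> Bgx; have := BD _ Bgx; rewrite /D /= in_itv /= andbT indicE.
  have [xA|_] := boolP (x \in A); last by rewrite mul0r ltxx.
  move: Bgx; rewrite indicE xA mul1r => Bfx _.
  by split => //; exact: set_mem.
by move=> [Ax Bfx]; rewrite indicE mem_set // mul1r.
Qed.
End IndependentFactor.

(** * Events of the chain before the target is hit *)

Section TabooEvents.
Variables (n : nat) (Om : pointedType) (X : nat -> Om -> 'I_n) (j : 'I_n).

(** Time 0 is excluded, as in the hitting time: the chain may start at [j]. *)
Definition avoid (k : nat) : set Om :=
  [set o | forall m, (m < k)%N -> X m.+1 o <> j].

Lemma avoidS k : avoid k.+1 = avoid k `&` ~` (X k.+1 @^-1` [set j]).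
Proof.
apply/seteqP; split => x /=.
  by move=> av; split=> [m mk|]; apply: av => //; exact: ltnW.
move=> [av avk] m; rewrite ltnS leq_eqVlt => /orP[/eqP->//|]; exact: av.
Qed.

Lemma avoid_past k o o' :
  (forall l, (l <= k)%N -> X l o = X l o') -> avoid k o -> avoid k o'.
Proof. by move=> eqX av m mk; rewrite -eqX //; exact: av. Qed.

(** Transition [k.+1] is charged exactly when no visit to [j] occurred at times
    [1] to [k]. *)
Lemma le_hit_time (R : realType) k o :
  ((k.+1%:R)%:E <= hit_time R X j o)%E = (o \in avoid k) :> bool.
Proof.
apply/ereal_infP/idP => [hit|/set_mem av _ [m [m0 Xm] <-]].
  apply/mem_set => m mk Xm.
  have /hit : [set (p%:R)%:E | p in [set p | (0 < p)%N /\ X p o = j]]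
      ((m.+1%:R)%:E : \bar R) by exists m.+1.
  by rewrite lee_fin ler_nat ltnS leqNgt mk.
rewrite lee_fin ler_nat ltnNge; apply/negP => mk.
by apply: (av m.-1); rewrite ?prednK.
Qed.

Lemma chain_sigma_coord k a : chain_sigma X (X k @^-1` [set a]).
Proof. by apply: sub_gen_smallest; exists k, a. Qed.

Lemma chain_sigmaI A B : chain_sigma X A -> chain_sigma X B ->
  chain_sigma X (A `&` B).
Proof.
pose G := [set A | exists k a, A = X k @^-1` [set a]].
exact: (@measurableI _ (g_sigma_algebraType G)).
Qed.

Lemma chain_sigma_avoid k : chain_sigma X (avoid k).
Proof.
pose G := [set A | exists k a, A = X k @^-1` [set a]].
elim: k => [|k IHk].
  have -> : avoid 0 = setT by apply/seteqP; split.
  exact: (@measurableT _ (g_sigma_algebraType G)).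
rewrite avoidS; apply: chain_sigmaI => //.
exact: (@measurableC _ (g_sigma_algebraType G) _ (chain_sigma_coord _ _)).
Qed.

End TabooEvents.

Section Markov.
Variables (R : realType) (n : nat) (P : 'M[R]_n) (i : 'I_n).
Variables (d : measure_display) (Om : measurableType d) (Pr : probability Om R).
Variables (X : nat -> Om -> 'I_n).
Hypothesis mc : markov_chain P i Pr X.

Lemma chain_sigma_measurable A : chain_sigma X A -> measurable A.
Proof.
apply: smallest_sub; first exact: sigma_algebra_measurable.
by move=> _ [k [a ->]]; exact: (mc_measurable mc).
Qed.

(** The Markov property is assumed for complete histories only.  An event of
    the past is a finite disjoint union of such histories. *)
Lemma markov_past k (F : set Om) a b : measurable F ->
  (forall o o', (forall l, (l <= k)%N -> X l o = X l o') -> F o -> F o') ->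
  Pr (F `&` X k @^-1` [set a] `&` X k.+1 @^-1` [set b]) =
  (Pr (F `&` X k @^-1` [set a]) * (P a b)%:E)%E.
Proof.
move=> mF Fpast.
pose past o := [ffun l : 'I_k.+1 => X l o].
have pastP o o' : past o = past o' <-> forall l, (l <= k)%N -> X l o = X l o'.
  split=> [/ffunP eqX l lk|eqX].
    by have := eqX (Ordinal (lk : (l < k.+1)%N)); rewrite !ffunE.
  by apply/ffunP => l; rewrite !ffunE eqX // -ltnS.
have mX l c : measurable (X l @^-1` [set c]) by exact: (mc_measurable mc).
have mpast h : measurable (past @^-1` [set h]).
  rewrite (_ : _ @^-1` _ =
      \bigcap_(l in `I_k.+1) (X l @^-1` [set h (inord l)])).
    by apply: bigcap_measurable => //; exists 0%N.
  apply/seteqP; split => x /= => [<- l lk /=|hx].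
    by rewrite ffunE inordK.
  by apply/ffunP => l; rewrite ffunE (hx l) ?inord_val /=.
have mFa : measurable (F `&` X k @^-1` [set a]) by exact: measurableI.
rewrite (measure_fiber_sum Pr mFa mpast) (measure_fiber_sum Pr _ mpast);
  last exact: measurableI.
rewrite ge0_sume_distrl; last by [].
apply: eq_bigr => h _.
have [[x [[Fx Xx] hx]]|no] := pselect (exists x,
    (F `&` X k @^-1` [set a] `&` past @^-1` [set h]) x).
  have cyl : F `&` X k @^-1` [set a] `&` past @^-1` [set h] =
      [set y | forall l, (l <= k)%N -> X l y = X l x].
    apply/seteqP; split => y /=.
      by move=> [_ hy]; apply/pastP; rewrite hy hx.
    move=> yx; split; last by rewrite -hx; apply/pastP.
    split; first by apply: Fpast Fx => l lk; rewrite yx.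
    by rewrite yx.
  rewrite setIAC cyl.
  by have := mc_step mc k (fun l => X l x) b; rewrite Xx.
have F0 : F `&` X k @^-1` [set a] `&` past @^-1` [set h] = set0.
  by apply/seteqP; split => x // Fx; case: no; exists x.
by rewrite setIAC F0 set0I measure0 mul0e.
Qed.

Definition taboo_event j k a : set Om := avoid X j k `&` X k @^-1` [set a].

Lemma chain_sigma_taboo_event j k a : chain_sigma X (taboo_event j k a).
Proof.
by apply: chain_sigmaI; [exact: chain_sigma_avoid|exact: chain_sigma_coord].
Qed.

Lemma taboo_step_event j k a b :
  Pr (taboo_event j k a `&` X k.+1 @^-1` [set b]) =
  (Pr (taboo_event j k a) * (P a b)%:E)%E.
Proof.
apply: (@markov_past _ (avoid X j k)); last by move=> o o' /avoid_past; apply.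
by apply: chain_sigma_measurable; exact: chain_sigma_avoid.
Qed.

Lemma taboo_event_prob j k a :
  Pr (taboo_event j k a) = ((taboo_mx P j ^+ k) i a)%:E.
Proof.
elim: k a => [|k IHk] a.
  have -> : taboo_event j 0 a = X 0 @^-1` [set a].
    by apply/seteqP; split => x //= -[].
  rewrite expr0 mxE; have [<-|ia] := eqVneq i a; first exact: (mc_init mc).
  have mX l c : measurable (X l @^-1` [set c]) by exact: (mc_measurable mc).
  rewrite mulr0n; apply/eqP; rewrite eq_le measure_ge0 andbT.
  have cN : Pr (~` (X 0 @^-1` [set i])) = 0%E.
    by rewrite probability_setC // (mc_init mc) subee.
  rewrite -[leRHS]cN; apply: le_measure; rewrite ?inE //.
    exact: measurableC.
  by move=> x /= -> ai; rewrite ai eqxx in ia.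
have [->|aj] := eqVneq a j.
  have -> : taboo_event j k.+1 j = set0.
    by rewrite /taboo_event avoidS; apply/seteqP; split => x //= -[[_ nj] /nj].
  rewrite measure0 exprSr mxE big1 // => b _.
  by rewrite [taboo_mx _ _ _ _]mxE eqxx mulr0.
have -> : taboo_event j k.+1 a = avoid X j k `&` X k.+1 @^-1` [set a].
  rewrite /taboo_event avoidS -setIA; congr (_ `&` _).
  by apply/seteqP; split => x /= [] //= -> //; split => //; exact/eqP.
have mX l c : measurable (X l @^-1` [set c]) by exact: (mc_measurable mc).
rewrite (measure_fiber_sum Pr _ (fun b => mX k b)); last first.
  apply: measurableI => //.
  by apply: chain_sigma_measurable; exact: chain_sigma_avoid.
rewrite exprSr mxE -sumEFin; apply: eq_bigr => b _.
rewrite setIAC; apply: etrans (taboo_step_event j k b a) _.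
by rewrite IHk -EFinM [taboo_mx _ _ _ _]mxE (negPf aj).
Qed.

End Markov.

(** * Mean weights *)

Lemma edge_weight_ge0 (R : realType) n (E : rel 'I_n) (eps : R) T f :
  0 < eps -> edge_weight_range E eps f -> forall a b (t : T), 0 <= f a b t.
Proof.
move=> e0 rf a b t; have [fE fN] := rf a b t.
have [/fE|/fN -> //] := boolP (E a b); exact/le_trans/ltW.
Qed.

Definition step_cost (R : realType) n (P W : 'M[R]_n) : 'cV[R]_n :=
  \col_a \sum_b P a b * W a b.

Lemma step_costD (R : realType) n (P A B : 'M[R]_n) h :
  step_cost P (h *: A + B) = h *: step_cost P A + step_cost P B.
Proof.
apply/colP => a; rewrite !mxE mulr_sumr -big_split; apply: eq_bigr => b _ /=.
by rewrite !mxE; ring.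
Qed.

Lemma step_cost_delta (R : realType) n (P : 'M[R]_n) l k :
  step_cost P (delta_mx l k) = P l k *: delta_mx l 0.
Proof.
apply/colP => a; rewrite !mxE (bigD1 k) //= big1 => [|b bk]; last first.
  by rewrite mxE (negPf bk) andbF mulr0.
rewrite mxE !eqxx !andbT addr0; have [->|] := eqVneq a l; first by [].
by rewrite !mulr0.
Qed.

Lemma row_mul_delta (R : realType) n (u : 'rV[R]_n) l :
  (u *m delta_mx l 0 : 'M[R]_1) 0 0 = u 0 l.
Proof. by rewrite -colE mxE. Qed.

Section MeanWeight.
Variables (R : realType) (n : nat) (E : rel 'I_n) (eps : R).
Variables (d : measure_display) (T : measurableType d) (Q : probability T R).
Variables (wt : 'I_n -> 'I_n -> {mfun T >-> R}).
Hypothesis wa : weight_assumptions E eps Q wt.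

Let wt_ge0 a b t : 0 <= wt a b t.
Proof. exact: edge_weight_ge0 (wa_eps wa) (wa_range wa) a b t. Qed.

Lemma expectation_weight a b : ('E_Q[wt a b] = (mean_weight Q wt a b)%:E)%E.
Proof.
rewrite mxE fineK // ge0_fin_numE; last exact: expectation_ge0.
have [/(wa_mean wa) //|Nab] := boolP (E a b).
rewrite (_ : (wt a b : T -> R) = cst 0) ?expectation_cst ?ltry //.
by apply/funext => t; have [_ ->] := wa_range wa a b t.
Qed.

Lemma mean_weight_ge0 a b : 0 <= mean_weight Q wt a b.
Proof. by rewrite -lee_fin -expectation_weight expectation_ge0. Qed.

Lemma mean_weight_edge a b : E a b -> eps <= mean_weight Q wt a b.
Proof.
move=> Eab; rewrite -lee_fin -expectation_weight -(expectation_cst Q eps).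
apply: expectation_le => //.
- by move=> t; exact: ltW (wa_eps wa).
- apply: aeW => t; by have [->] := wa_range wa a b t.
Qed.

Lemma mean_weight_nonedge a b : ~~ E a b -> mean_weight Q wt a b = 0.
Proof.
move=> Nab; apply: EFin_inj; rewrite -expectation_weight.
rewrite (_ : (wt a b : T -> R) = cst 0) ?expectation_cst //.
by apply/funext => t; have [_ ->] := wa_range wa a b t.
Qed.
End MeanWeight.

(** * Mean weighted hitting times and the Kemeny constant *)

Section Walk.
Variables (R : realType) (n : nat) (E : rel 'I_n) (P : 'M[R]_n) (eps : R).
Variables (d : measure_display) (T : measurableType d) (Q : probability T R).
Variables (wt : 'I_n -> 'I_n -> {mfun T >-> R}).
Variables (d' : measure_display) (Om : measurableType d').
Variables (Pr : 'I_n -> probability Om R) (X : nat -> Om -> 'I_n).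
Variables (w : nat -> 'I_n -> 'I_n -> {mfun Om >-> R}).
Hypothesis P_ge0 : forall a b, 0 <= P a b.
Hypothesis wa : weight_assumptions E eps Q wt.
Hypothesis ww : weighted_walk E P eps Q wt Pr X w.

Let w_ge0 k a b o : 0 <= w k a b o.
Proof. exact: edge_weight_ge0 (wa_eps wa) (ww_range ww k) a b o. Qed.

Let wt_ge0 a b t : 0 <= wt a b t.
Proof. exact: edge_weight_ge0 (wa_eps wa) (wa_range wa) a b t. Qed.

Definition edge_event j k (p : 'I_n * 'I_n) : set Om :=
  taboo_event X j k p.1 `&` X k.+1 @^-1` [set p.2].

Lemma chain_sigma_edge_event j k p : chain_sigma X (edge_event j k p).
Proof.
apply: chain_sigmaI; [exact: chain_sigma_taboo_event|exact: chain_sigma_coord].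
Qed.

(** At each time exactly one pair [p] can be the edge in use, so the inner sum
    has at most one nonzero term; it turns the random index of the weight into
    a deterministic one, which is what independence applies to. *)
Lemma weighted_hit_timeE j o :
  (weighted_hit_time X (fun k a b => w k a b) j o =
  \sum_(0 <= k <oo) \sum_p (\1_(edge_event j k p) o * w k.+1 p.1 p.2 o)%:E)%E.
Proof.
rewrite /weighted_hit_time eseries_mkcond -(nneseries_addn 1); last first.
  by move=> k; case: ifP => // _; rewrite lee_fin.
apply: eq_eseriesr => k _; rewrite addn1 le_hit_time /=.
rewrite (bigD1 (X k o, X k.+1 o)) //= big1 ?adde0; last first.
  move=> [a b] /= ab; rewrite indicE memNset ?mul0r // => -[[_ /= Xa] /= Xb].
  by move: ab; rewrite -Xa -Xb eqxx.
case: ifPn => [/set_mem av|/negP av].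
  by rewrite indicE mem_set ?mul1r.
by rewrite indicE memNset ?mul0r // => -[[av' _] _]; exact/av/mem_set.
Qed.

(** The event depends on the chain only and the weight is independent of the
    chain, so their means multiply. *)
Lemma edge_event_mean i j k p :
  (\int[Pr i]_o (\1_(edge_event j k p) o * w k.+1 p.1 p.2 o)%:E =
  ((taboo_mx P j ^+ k) i p.1 * (P p.1 p.2 * mean_weight Q wt p.1 p.2))%:E)%E.
Proof.
have mc := ww_chain ww i.
have A_sigma : chain_sigma X (edge_event j k p).
  exact: chain_sigma_edge_event.
have PrA : Pr i (edge_event j k p) = ((taboo_mx P j ^+ k) i p.1 * P p.1 p.2)%:E.
  by rewrite (taboo_step_event mc) (taboo_event_prob mc) EFinM.
have a0 : 0 <= (taboo_mx P j ^+ k) i p.1 * P p.1 p.2.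
  by rewrite -lee_fin -PrA measure_ge0.
rewrite (integral_indic_indep (nu := Q) (h := wt p.1 p.2) (a := NngNum a0)) //=.
- rewrite -[(\int[Q]_t _)%E]expectation_def (expectation_weight wa).
  by rewrite -EFinM mulrA.
- exact: chain_sigma_measurable mc _ A_sigma.
- move=> B mB; rewrite -PrA -(ww_law ww i k.+1 p.1 p.2 mB).
  apply: (ww_indep ww) => //.
  by apply: sub_gen_smallest; exists k.+1, p.1, p.2, B.
Qed.

Lemma mean_hit_time_series i j :
  mean_hit_time Pr X w i j =
  (\sum_(0 <= k <oo)
    ((taboo_mx P j ^+ k *m step_cost P (mean_weight Q wt)) i 0)%:E)%E.
Proof.
have mc := ww_chain ww i.
have mterm k p : measurable_fun setT
    (fun o => (\1_(edge_event j k p) o * w k.+1 p.1 p.2 o)%:E).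
  apply/measurable_EFinP; apply: measurable_funM => //.
  apply: measurable_indic; apply: chain_sigma_measurable mc _ _.
  exact: chain_sigma_edge_event.
have term0 k p o : (0 <= (\1_(edge_event j k p) o * w k.+1 p.1 p.2 o)%:E)%E.
  by rewrite lee_fin mulr_ge0.
rewrite /mean_hit_time; under eq_integral do rewrite weighted_hit_timeE.
rewrite integral_nneseries //=; last 2 first.
- by move=> k; exact: emeasurable_sum.
- by move=> k o _; exact: sume_ge0.
apply: eq_eseriesr => k _.
rewrite ge0_integral_sum //= (eq_bigr _ (fun p _ => edge_event_mean i j k p)).
rewrite sumEFin mxE; congr EFin.
rewrite -(pair_big xpredT xpredT (fun a b => (taboo_mx P j ^+ k) i a *
  (P a b * mean_weight Q wt a b))) /=.
by apply: eq_bigr => a _; rewrite mxE mulr_sumr.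
Qed.

Lemma step_cost_ge0 a : 0 <= step_cost P (mean_weight Q wt) a 0.
Proof.
rewrite mxE sumr_ge0 // => b _; rewrite mulr_ge0 //.
exact: mean_weight_ge0 wa a b.
Qed.

Variable pi : 'rV[R]_n.
Hypothesis irr : irreducible_chain P.
Hypothesis P1 : forall i, \sum_j P i j = 1.
Hypothesis uni : unique_stationary P pi.

Lemma mean_hit_time_lim i j : mean_hit_time Pr X w i j =
  (limn (fun N => taboo_sum P (step_cost P (mean_weight Q wt)) j N i 0))%:E.
Proof.
have c0 := step_cost_ge0.
have cv := @taboo_sum_cvg _ _ _ _ j P_ge0 c0 irr _ uni.1 i.
rewrite mean_hit_time_series -lim_mkord -EFin_lim //; congr (limn _).
by apply/funext => N /=; rewrite sumEFin /taboo_sum summxE.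
Qed.

Lemma weighted_kemenyE : weighted_kemeny pi Pr X w =
  (\tr (fundamental_mx P pi) * (pi *m step_cost P (mean_weight Q wt)) 0 0)%:E.
Proof.
have c0 := step_cost_ge0.
have pi_gt0 := stationary_gt0 P_ge0 irr uni.1.
have uA := fundamental_unitmx P1 pi_gt0 uni.
pose M : 'M[R]_n := \matrix_(i, j)
  limn (fun N => taboo_sum P (step_cost P (mean_weight Q wt)) j N i 0).
pose c := step_cost P (mean_weight Q wt).
rewrite -(@kemeny_identity _ _ P pi P1 uni.1 uA c M) //.
- rewrite /weighted_kemeny -sumEFin; apply: eq_bigr => i _.
  rewrite -sumEFin; apply: eq_bigr => j _.
  by rewrite mean_hit_time_lim !mxE !EFinM.
- move=> i j; rewrite mxE (taboo_limit_first_step j P_ge0 c0 irr uni.1).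
  by congr (_ + _); apply: eq_bigr => b _; rewrite mxE.
Qed.

End Walk.

(** * Deterministic weights *)

Section DeterministicWeights.
Variables (R : realType) (n : nat) (E : rel 'I_n) (P : 'M[R]_n) (eps delta : R).
Variables (d : measure_display) (T : measurableType d) (Q : probability T R).
Variables (wt : 'I_n -> 'I_n -> {mfun T >-> R}).
Variables (d' : measure_display) (Om : measurableType d').
Variables (Pr : 'I_n -> probability Om R) (X : nat -> Om -> 'I_n).
Variables (w : nat -> 'I_n -> 'I_n -> {mfun Om >-> R}).
Hypothesis ww : weighted_walk E P eps Q wt Pr X w.

Variable V : 'M[R]_n.
Hypothesis delta_gt0 : 0 < delta.
Hypothesis V_edge : forall a b, E a b -> delta <= V a b.
Hypothesis V_nonedge : forall a b, ~~ E a b -> V a b = 0.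

Definition const_weight d0 (U : measurableType d0) (a b : 'I_n) :
  {mfun U >-> R} := cst (V a b).

Lemma const_weight_sigma (B : set Om) :
  weight_sigma (fun _ => @const_weight _ Om) B -> B = set0 \/ B = setT.
Proof.
move: B; apply: smallest_sub => [|_ [k [a [b [B [mB ->]]]]]]; last first.
  by rewrite preimage_cst; case: ifP; [right|left].
split=> [|A [->|->]|F F01]; first by left.
- by right; rewrite setD0.
- by left; rewrite setDv.
have [[m Fm]|no] := pselect (exists m, F m = setT).
  by right; apply/seteqP; split => // x _; exists m => //; rewrite Fm.
left; apply: bigcup0 => m _.
by have [//|Fm] := F01 m; case: no; exists m.
Qed.

Lemma mean_const_weight : mean_weight Q (@const_weight _ T) = V.
Proof. by apply/matrixP => a b; rewrite mxE expectation_cst. Qed.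

Lemma const_weight_assumptions :
  weight_assumptions E delta Q (@const_weight _ T).
Proof.
split=> //.
- by move=> a b t; split=> [/V_edge|/V_nonedge].
- by move=> a b _; rewrite expectation_cst ltry.
- by move=> a b _; rewrite (expectation_cst Q (V a b ^+ 2)) ltry.
Qed.

(** The chain of a given walk can carry any admissible matrix [V] of constant
    weights: constants generate the trivial sigma-algebra, which is
    independent of everything. *)
Lemma const_weighted_walk : weighted_walk E P delta Q (@const_weight _ T) Pr X
  (fun _ => @const_weight _ Om).
Proof.
split.
- exact: ww_chain ww.
- by move=> k a b t; split=> [/V_edge|/V_nonedge].
- move=> i k a b B mB; rewrite !preimage_cst.
  by case: ifP; rewrite ?probability_setT ?measure0.
- move=> i A B _ wB.
  have [->|->] : B = set0 \/ B = setT.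
    exact: const_weight_sigma wB.
  + by rewrite setI0 measure0 mule0.
  + by rewrite setIT probability_setT mule1.
Qed.

End DeterministicWeights.

(** * The derivative *)

Unset Implicit Arguments.

Theorem theorem4 (R : realType) (n : nat) (E : rel 'I_n) (P : 'M[R]_n)
    (pi : 'rV[R]_n) (eps : R)
    (d : measure_display) (T : measurableType d) (Q : probability T R)
    (wt : 'I_n -> 'I_n -> {mfun T >-> R})
    (d' : measure_display) (Om : measurableType d')
    (Pr : 'I_n -> probability Om R) (X : nat -> Om -> 'I_n)
    (w : nat -> 'I_n -> 'I_n -> {mfun Om >-> R}) :
  markovian_graph E P ->
  unique_stationary P pi ->
  weight_assumptions E eps Q wt ->
  weighted_walk E P eps Q wt Pr X w ->
  (exists K : 'M[R]_n -> R, kemeny_function E P pi K) /\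
  (forall K : 'M[R]_n -> R, kemeny_function E P pi K ->
   forall l k : 'I_n, E l k ->
   is_derive (mean_weight Q wt) (delta_mx l k) K
     (\tr (fundamental_mx P pi) * pi 0 l * P l k)).
Proof.
move=> mg uni wa ww.
have P_ge0 a b : 0 <= P a b.
  by have [/(mg_edge mg)|/(mg_nonedge mg)->] := boolP (E a b).
have [_ _ _ P1 irr _] := mg.
pose K0 (W : 'M[R]_n) := \tr (fundamental_mx P pi) * (pi *m step_cost P W) 0 0.
have K0E : kemeny_function E P pi K0.
  move=> eps0 d0 T0 Q0 wt0 d0' Om0 Pr0 X0 w0 wa0 ww0.
  by rewrite (weighted_kemenyE P_ge0 wa0 ww0 irr P1 uni).
split; first by exists K0.
move=> K KE l k Elk; set W := mean_weight Q wt; set D := delta_mx l k.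
(* K is prescribed only at mean weight matrices.  Along the direction D the
   matrices near W stay mean weight matrices on E, with the lower bound eps / 2
   in place of eps, and constant weights realize them. *)
have KK0 h : `|h| <= eps / 2 -> K (h *: D + W) = K0 (h *: D + W).
  move=> hle; have eps0 := wa_eps wa.
  have VE a b : E a b -> eps / 2 <= (h *: D + W) a b.
    move=> Eab; have := mean_weight_edge wa Eab; rewrite -/W !mxE => We.
    move: hle; rewrite ler_norml => /andP[h1 h2].
    by case: (_ && _); rewrite ?mulr1 ?mulr0; lra.
  have VN a b : ~~ E a b -> (h *: D + W) a b = 0.
    move=> Nab; rewrite mxE (mean_weight_nonedge wa Nab) addr0 !mxE.
    case: andP => [[/eqP al /eqP bk]|_]; last by rewrite mulr0.
    by rewrite al bk Elk in Nab.
  have e2 : 0 < eps / 2 by lra.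
  have wa' := const_weight_assumptions Q e2 VE VN.
  have ww' := const_weighted_walk ww VE VN.
  have := KE _ _ _ _ _ _ _ _ _ _ wa' ww'.
  rewrite (K0E _ _ _ _ _ _ _ _ _ _ wa' ww') mean_const_weight.
  by case=> ->.
set df := \tr (fundamental_mx P pi) * pi 0 l * P l k.
have K0D h : K0 (h *: D + W) = K0 W + h * df.
  rewrite /K0 /df step_costD step_cost_delta mulmxDr -!scalemxAr.
  have := row_mul_delta pi l.
  move: (pi *m step_cost P W) (pi *m delta_mx l 0) => u v vE.
  by rewrite !mxE vE; ring.
have lim0 : h^-1 *: ((K \o shift W) (h *: D) - K W) @[h --> 0^'] --> df.
  apply: cvg_near_cst.
  have e2 : 0 < eps / 2 by have := wa_eps wa; lra.
  near=> h.
  have h0 : h != 0 by near: h; exact: nbhs_dnbhs_neq.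
  have hle : `|h| <= eps / 2 by near: h; apply: dnbhs0_le.
  have KW : K W = K0 W.
    by have := KK0 0; rewrite normr0 scale0r add0r; apply; exact: ltW.
  rewrite /= KK0 // KW K0D addrC addKr /GRing.scale /= mulKf //.
split; first by apply/cvg_ex; exists df.
exact: cvg_lim.
Unshelve. all: by end_near.
Qed.
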